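(* Let $\mathcal{M}=(M_1,\dots,M_q)$ be a sequence of (pairwise) commuting diagonalizable matrices in $\mathcal{M}_n(\mathbb{C})$, and let $S\in\mathfrak{S}(\mathcal{M})$ be such that $(\mathbf{m}^1=\Delta_{M_1}(S),\dots,\mathbf{m}^q=\Delta_{M_q}(S))$ is a star sequence of (induced) vectors, with associated star sequence of indices $(I_1,\dots,I_q)$, where $I_q=\{\boldsymbol{\alpha}^q_1<\dots<\boldsymbol{\alpha}^q_{\mathfrak{c}(q)}\}$, and associated block sizes $k_{\boldsymbol{\alpha}^q_1},\dots,k_{\boldsymbol{\alpha}^q_{\mathfrak{c}(q)}}$. The following statements hold. (i) If $(\mathbf{n}^1,\dots,\mathbf{n}^q)$ is a sequence of induced vectors by $\mathcal{M}$, then there is $\sigma\in\mathcal{S}_n$ such that $\mathbf{n}^j=\mathbf{m}^j_\sigma$ for all $j\in\{1,\dots,q\}$. (ii) $$\mathfrak{S}(\mathcal{M})=\{S(Y_{\boldsymbol{\alpha}^q_1}\oplus\dots\oplus Y_{\boldsymbol{\alpha}^q_{\mathfrak{c}(q)}})P_\sigma\mid\sigma\in\mathcal{S}_n,\ Y_{\boldsymbol{\alpha}^q_p}\in\mathcal{M}^{\mathrm{inv}}_{k_{\boldsymbol{\alpha}^q_p}}(\mathbb{C})\}.$$ For all $j\in\{1,\dots,q\}$ (and all such $\sigma$ and $Y_{\boldsymbol{\alpha}^q_p}$) we have $\Delta_{M_j}(S(Y_{\boldsymbol{\alpha}^q_1}\oplus\dots\oplus Y_{\boldsymbol{\alpha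}^q_{\mathfrak{c}(q)}})P_\sigma)=\mathbf{m}^j_\sigma$.
   Context: $\mathcal{M}_n(\mathbb{C})$ is the set of complex $n\times n$ matrices, $\mathcal{M}^{\mathrm{inv}}_n(\mathbb{C})$ the subset of invertible ones. For a diagonalizable $M$, $\mathfrak{S}(M)$ is the set of invertible $S$ with $S^{-1}MS$ diagonal, and $\Delta_M(S)\in\mathbb{C}^n$ is the vector $\mathbf{m}$ with $\mathrm{diag}(\mathbf{m})=S^{-1}MS$. $\mathfrak{S}(\mathcal{M})=\bigcap_j\mathfrak{S}(M_j)$. A sequence of induced vectors by $\mathcal{M}$ is one of the form $(\Delta_{M_1}(V),\dots,\Delta_{M_q}(V))$ with $V\in\mathfrak{S}(\mathcal{M})$. $\mathcal{S}_n$ is the set of permutations of $\{1,\dots,n\}$; for $\mathbf{m}=(m_1,\dots,m_n)$, $\mathbf{m}_\sigma=(m_{\sigma(1)},\dots,m_{\sigma(n)})$; $P_\sigma$ is the matrix with columns $\mathbf{e}_{\sigma(1)},\dots,\mathbf{e}_{\sigma(n)}$, i.e. $(P_\sigma)_{ij}=\delta_{i\sigma(j)}$. $Y_1\oplus\dots\oplus Y_d$ is the block diagonal matrix with diagonal blocks $Y_1,\dots,Y_d$. $\mathbf{1}_k$ is the all-ones vector of length $k$. Star sequence of indices: $(I_1,\dots,I_q)$ with $I_j\subset(\mathbb{N}^* )^j$, $I_1=\{1,\dots,\mathfrak{c}(1)\}$ for some $\mathfrak{c}(1)\in\mathbb{N}^*$, and for each $j\in\{1,\dots,q-1\}$ and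 $\boldsymbol{\alpha}\in I_j$ there is $\delta_{\boldsymbol{\alpha}}\in\mathbb{N}^*$ such that $I_{j+1}=\{(\boldsymbol{\alpha},i)\mid\boldsymbol{\alpha}\in I_j,\ 1\le i\le\delta_{\boldsymbol{\alpha}}\}$. $\mathfrak{c}(j)$ is the number of elements of $I_j$, and $I_j=\{\boldsymbol{\alpha}^j_1<\dots<\boldsymbol{\alpha}^j_{\mathfrak{c}(j)}\}$ in lexicographic order. Star sequence of vectors: $(\mathbf{m}^1,\dots,\mathbf{m}^q)$ in $\mathbb{C}^n$ is a star sequence of vectors if there are a star sequence of indices $(I_1,\dots,I_q)$, complex numbers $\lambda_{\boldsymbol{\alpha}}$ and positive integers $k_{\boldsymbol{\alpha}}$ ($\boldsymbol{\alpha}\in I_1\cup\dots\cup I_q$) such that: $\mathbf{m}^1=(\lambda_1\mathbf{1}_{k_1},\dots,\lambda_{\mathfrak{c}(1)}\mathbf{1}_{k_{\mathfrak{c}(1)}})$ (concatenation) with $\lambda_1,\dots,\lambda_{\mathfrak{c}(1)}$ distinct and $k_1+\dots+k_{\mathfrak{c}(1)}=n$; and for $j>1$, $\mathbf{m}^j=(\lambda_{\boldsymbol{\alpha}^j_1}\mathbf{1}_{k_{\boldsymbol{\alpha}^j_1}},\dots,\lambda_{\boldsymbol{\alpha}^j_{\mathfrak{c}(j)}}\mathbf{1}_{k_{\boldsymbol{\alpha}^j_{\mathfrak{c}(j)}}})$, where for each $\boldsymbol{\beta}\in I_{j-1}$ the numbers $\lambda_{(\boldsymbol{\beta},1)},\dots,\lambda_{(\boldsymbol{\beta},\delta_{\boldsymbol{\beta}})}$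 are distinct and $\sum_{i=1}^{\delta_{\boldsymbol{\beta}}}k_{(\boldsymbol{\beta},i)}=k_{\boldsymbol{\beta}}$. *)

(* Defs.v *)
From HB Require Import structures.
From mathcomp Require Import all_boot all_order all_algebra all_fingroup.
From mathcomp Require Import finmap.
From mathcomp Require Import boolp classical_sets reals.
From mathcomp.real_closed Require Import complex.

Set Implicit Arguments.
Unset Strict Implicit.
Unset Printing Implicit Defensive.

Import Order.TTheory GRing.Theory Num.Theory.

Local Open Scope classical_set_scope.
Local Open Scope fset_scope.
Local Open Scope ring_scope.

Section Diagonalizing.
Variable F : fieldType.

Definition diagonalizers n (M : 'M[F]_n) : set 'M[F]_n :=
  [set S | S \in unitmx /\ is_diag_mx (invmx S *m M *m S)].

(* Total in S; its value is meaningful when [diagonalizers M S], see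
   [diag_mx_Delta]. *)
Definition Delta n (M S : 'M[F]_n) : 'rV[F]_n :=
  \row_i (invmx S *m M *m S) i i.

Lemma diag_mx_Delta n (M S : 'M[F]_n) :
  diagonalizers M S -> diag_mx (Delta M S) = invmx S *m M *m S.
Proof.
move=> [_ /is_diag_mxP D]; apply/matrixP => i j; rewrite !mxE.
by case: (eqVneq i j) => [->|ij]; rewrite ?mulr1n ?mulr0n ?mxE // -[LHS](D i j) ?mxE.
Qed.

Definition common_diagonalizers n q (M : 'I_q -> 'M[F]_n) : set 'M[F]_n :=
  \bigcap_j diagonalizers (M j).

Definition induced_vectors n q (M : 'I_q -> 'M[F]_n) (v : 'I_q -> 'rV[F]_n) :=
  exists2 V, common_diagonalizers M V & forall j, v j = Delta (M j) V.

Definition Pmx n (s : 'S_n) : 'M[F]_n := \matrix_(i, j) (i == s j)%:R.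

Definition permute_vec n (s : 'S_n) (v : 'rV[F]_n) : 'rV[F]_n :=
  \row_i v 0 (s i).

End Diagonalizing.

(* A multi-index is a [seq nat] with positive entries, and [I j] is the set of
   multi-indices of length j, for 1 <= j <= q; other values of [I] are
   irrelevant. [delta a] is the number of children of [a]. *)
Definition star_indices (q : nat) (I : nat -> {fset seq nat})
    (delta : seq nat -> nat) : Prop :=
  [/\ (0 < q)%N,
      exists2 c1, (0 < c1)%N & I 1%N = [fset [:: i] | i in iota 1 c1],
      forall j, (0 < j < q)%N -> forall a, a \in I j -> (0 < delta a)%N
    & forall j, (0 < j < q)%N ->
        I j.+1 = [fset rcons a i | a in I j, i in iota 1 (delta a)]].

Definition lexi_enum (A : {fset seq nat}) : seq (seq nat) :=
  sort (fun a b : seqlexi nat => (a <= b)%O) A.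

(* Families over 'I_q are 0-based: the j-th vector goes with [I j.+1].
   Equality of the entry sequences also asserts that the concatenated blocks
   have total length n. *)
Definition star_vectors (F : fieldType) (n q : nat) (m : 'I_q -> 'rV[F]_n)
    (I : nat -> {fset seq nat}) (delta : seq nat -> nat)
    (lam : seq nat -> F) (k : seq nat -> nat) : Prop :=
  star_indices q I delta /\
  [/\ forall j, (0 < j <= q)%N -> forall a, a \in I j -> (0 < k a)%N,
      uniq [seq lam a | a <- lexi_enum (I 1%N)]
        /\ (\sum_(a <- lexi_enum (I 1%N)) k a)%N = n,
      forall j, (0 < j < q)%N -> forall b, b \in I j ->
        uniq [seq lam (rcons b i) | i <- iota 1 (delta b)]
        /\ (\sum_(i <- iota 1 (delta b)) k (rcons b i))%N = k b
    & forall j : 'I_q, [seq m j 0 i | i <- enum 'I_n] =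
        flatten [seq nseq (k a) (lam a) | a <- lexi_enum (I j.+1)]].

Definition block_size (A : {fset seq nat}) (k : seq nat -> nat)
    (p : 'I_#|` A|) : nat := k (nth [::] (lexi_enum A) p).

Lemma star_block_size (F : fieldType) (n q : nat) (m : 'I_q -> 'rV[F]_n)
    (I : nat -> {fset seq nat}) (delta : seq nat -> nat)
    (lam : seq nat -> F) (k : seq nat -> nat) :
  star_vectors m I delta lam k ->
  (\sum_(p < #|` I q|) block_size k p)%N = n.
Proof.
case: q m => [|q] m [[q_gt0 _ _ _] [_ _ _ mE]] //.
have /= := congr1 size (mE ord_max).
rewrite size_map size_enum_ord size_flatten /shape -map_comp.
rewrite (eq_map (g := k)) => [|a]; last by rewrite /= size_nseq.
move=> ->; rewrite sumnE big_map (big_nth [::]) big_mkord /block_size.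
by rewrite /lexi_enum size_sort.
Qed.

(* [\mxdiag] has dimension a sum of block sizes; [e] casts it to n. *)
Definition direct_sum (F : fieldType) (n c : nat) (sz : 'I_c -> nat)
    (e : (\sum_(p < c) sz p)%N = n) (Y : forall p, 'M[F]_(sz p)) : 'M[F]_n :=
  castmx (e, e) (\mxdiag_(p < c) Y p).

(* Main.v *)
(** If [T] is another common diagonalizer, then [X = S^-1 T] intertwines the
    diagonal matrices of the induced vectors: [m^j_a X_ab = X_ab n^j_b].  Since
    [det X <> 0] some permutation [s] has all [X (s b) b <> 0], so that
    [n^j = m^j_s], and [Z = X P_s^-1] has its support on the pairs [(a, b)] with
    [m^j_a = m^j_b] for all [j].  The star condition says exactly that these are
    the pairs lying in a common block indexed by [I_q]: the multi-index of length
    [j] above position [x] is the prefix of the one of length [q], and distinct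
    siblings carry distinct values [lam]. *)

Require Import Defs.
From HB Require Import structures.
From mathcomp Require Import all_boot all_order all_algebra all_fingroup.
From mathcomp Require Import finmap.
From mathcomp Require Import boolp classical_sets reals.
From mathcomp.real_closed Require Import complex.

Set Implicit Arguments.
Unset Strict Implicit.
Unset Printing Implicit Defensive.

Import Order.TTheory GRing.Theory Num.Theory.

Local Open Scope classical_set_scope.
Local Open Scope ring_scope.

(** * Lexicographic enumeration of one level of multi-indices from the previous level *)

Section LexiEnum.

Lemma lexi_enum_uniq (A : {fset seq nat}) : uniq (lexi_enum A).
Proof. by rewrite sort_uniq fset_uniq. Qed.

Lemma mem_lexi_enum (A : {fset seq nat}) : lexi_enum A =i A.
Proof. exact: mem_sort. Qed.

(** Equal lengths align the two last entries, so they matter only when everything before them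
    ties. *)
Lemma ltxi_rcons (a b : seq nat) i j : size a = size b ->
  (rcons a i < rcons b j :> seqlexi nat)%O =
    (a < b :> seqlexi nat)%O || (a == b) && (i < j)%N.
Proof.
elim: a b => [|x a IHa] [|y b] //=.
  by move=> _; rewrite ltxi_cons ltxx implybF leEnat; case: (ltngtP i j).
case=> /IHa {}IHa; rewrite !ltxi_cons IHa eqseq_cons !leEnat.
by case: (ltngtP x y).
Qed.

(** Both lists are strictly increasing with the same members. The right-hand side groups the
    children by parent, which is what makes the blocks of one level refine those of the level
    above. *)
Lemma lexi_enum_rcons (A : {fset seq nat}) (d : seq nat -> nat) l :
  {in A, forall a, size a = l} ->
  lexi_enum [fset rcons a i | a in A, i in iota 1 (d a)]%fset =
    [seq rcons a i | a <- lexi_enum A, i <- iota 1 (d a)].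
Proof.
move=> sizeA; apply: (@lt_sorted_eq _ (seqlexi nat)).
- by rewrite sort_lt_sorted fset_uniq.
(* Unlike [sorted], [pairwise] splits over the concatenation of the groups of siblings. *)
- rewrite (sorted_pairwise lt_trans).
  have: pairwise (fun a b : seqlexi nat => a < b)%O (lexi_enum A).
    by rewrite -(sorted_pairwise lt_trans) sort_lt_sorted fset_uniq.
  have: {subset lexi_enum A <= A} by move=> a; rewrite mem_lexi_enum.
  elim: (lexi_enum A) => //= a s IHs sA /andP[/allP as_ s_lt].
  have {}IHs := IHs (fun b bs => sA b (mem_behead (s := a :: s) bs)) s_lt.
  rewrite pairwise_cat IHs andbT; apply/andP; split.
    apply/allrelP => _ _ /mapP[i _ ->] /allpairsPdep[b [j [bs _ ->]]].
    rewrite ltxi_rcons ?as_ //.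
    by rewrite !sizeA ?sA ?mem_head // inE bs orbT.
  rewrite pairwise_map -(sorted_pairwise _); last first.
    by move=> u v w /=; apply: lt_trans.
  rewrite (@eq_sorted _ _ ltn) ?iota_ltn_sorted // => i j /=.
  by rewrite ltxi_rcons // ltxx eqxx.
- move=> b; rewrite mem_lexi_enum.
  apply/imfset2P/allpairsPdep => [[a /= aA [i iP ->]]|[a [i [aA iP ->]]]].
    by exists a, i; rewrite mem_lexi_enum.
  by exists a; rewrite /= -?mem_lexi_enum //; exists i.
Qed.

End LexiEnum.

(* The multi-index of the block containing each coordinate. *)
Definition labels (k : seq nat -> nat) (s : seq (seq nat)) : seq (seq nat) :=
  flatten [seq nseq (k a) a | a <- s].

(** * Block labels of coordinates, and their passage to the parent level *)

Section Labels.
Variable k : seq nat -> nat.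
Implicit Types s : seq (seq nat).

Lemma size_labels s : size (labels k s) = (\sum_(a <- s) k a)%N.
Proof.
rewrite size_flatten /shape -map_comp sumnE big_map.
by apply: eq_bigr => a _; rewrite /= size_nseq.
Qed.

Lemma map_labels (T : Type) (f : seq nat -> T) s :
  [seq f a | a <- labels k s] = flatten [seq nseq (k a) (f a) | a <- s].
Proof.
rewrite map_flatten -map_comp; congr flatten; apply: eq_map => a.
by rewrite /= map_nseq.
Qed.

Lemma labels_sub s : {subset labels k s <= s}.
Proof. by move=> a /flatten_mapP[b bs /nseqP[-> _]]. Qed.

(** The children of [a] fill consecutive runs of total length [k a], and truncation to length [l]
    turns each of their labels back into [a]. *)
Lemma labels_parent s (d : seq nat -> nat) l :
  {in s, forall a, size a = l} ->
  {in s, forall a, (\sum_(i <- iota 1 (d a)) k (rcons a i))%N = k a} ->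
  [seq take l a | a <- labels k [seq rcons a i | a <- s, i <- iota 1 (d a)]]
    = labels k s.
Proof.
rewrite /labels; elim: s => //= a s IHs size_s k_s.
rewrite map_cat flatten_cat map_cat; congr (_ ++ _); last first.
  by apply: IHs => b bs; [apply: size_s|apply: k_s]; rewrite inE bs orbT.
rewrite -map_comp -/(labels _ _) -k_s ?mem_head //.
elim: (iota _ _) => [|i r IHr]; first by rewrite big_nil.
rewrite big_cons nseqD /= map_cat IHr map_nseq -cats1.
by rewrite take_size_cat // size_s ?mem_head.
Qed.

(** Links the list description of the blocks with the indexing of [\mxdiag]: in both, a position is
    the total size of the earlier blocks plus an offset inside its own block. *)
Lemma labels_sig1 s c (x : 'I_(\sum_(p < c) k (nth [::] s p))) : c = size s ->
  nth [::] (labels k s) x = nth [::] s (tagnat.sig1 x).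
Proof.
move=> cE.
rewrite nth_flatten.
set sh := shape _.
have shE : sh = [seq k a | a <- s].
  by rewrite /sh /shape -map_comp; apply: eq_map => a; rewrite /= size_nseq.
have sig1_lt : (tagnat.sig1 x < size s)%N by rewrite -cE.
have xE : x = flatten_index sh (tagnat.sig1 x) (tagnat.sig2 x) :> nat.
  rewrite [LHS]tagnat.rect /flatten_index; congr addn.
  rewrite shE -map_take sumnE big_map (big_nth [::]) size_take sig1_lt.
  rewrite big_mkord; transitivity (\sum_(i < tagnat.sig1 x) k (nth [::] s i))%N.
    exact/esym/(big_ord_widen c (fun i => k (nth [::] s i)))/ltnW/ltn_ord.
  by apply: eq_bigr => i _; rewrite nth_take.
have lt_sh : (tagnat.sig2 x < nth 0 sh (tagnat.sig1 x))%N.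
  by rewrite shE (nth_map [::]).
rewrite {1 2}xE flatten_indexKl ?flatten_indexKr // (nth_map [::]) // nth_nseq.
by rewrite ltn_ord.
Qed.

End Labels.

(** * Intertwining of diagonal matrices, and the factorization of common diagonalizers *)

Section CommonDiagonalizers.
Variable F : fieldType.

Lemma mul_Pmx m n (A : 'M[F]_(m, n)) (s : 'S_n) i j :
  (A *m Pmx F s) i j = A i (s j).
Proof.
rewrite mxE (bigD1 (s j)) //= mxE eqxx mulr1 big1 ?addr0 // => l ls.
by rewrite mxE (negPf ls) mulr0.
Qed.

Lemma Pmx_unit n (s : 'S_n) : Pmx F s \in unitmx.
Proof.
(* [perm_mx] applies its permutation to the row index, hence the inverse. *)
suff -> : Pmx F s = perm_mx s^-1 by rewrite unitmx_perm.
apply/matrixP => i j; rewrite !mxE.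
by rewrite -[in RHS](inj_eq (@perm_inj _ s)) permKV.
Qed.

Lemma diagonalizers_mul n (M T : 'M[F]_n) :
  diagonalizers M T -> M *m T = T *m diag_mx (Delta M T).
Proof.
by move=> TM; have [Tu _] := TM; rewrite diag_mx_Delta // !mulmxA mulmxV // mul1mx.
Qed.

Lemma mul_diagonalizers n (M T : 'M[F]_n) (d : 'rV[F]_n) :
  T \in unitmx -> M *m T = T *m diag_mx d ->
  diagonalizers M T /\ Delta M T = d.
Proof.
move=> Tu MT.
have E : invmx T *m M *m T = diag_mx d by rewrite -mulmxA MT mulmxA mulVmx // mul1mx.
split; first by split => //=; rewrite E diag_mx_is_diag.
by apply/rowP => i; rewrite mxE E mxE eqxx mulr1n.
Qed.

(** The entries of the two sides are [u 0 a * X a b] and [X a b * v 0 b], and a nonzero [X a b]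
    cancels. *)
Lemma diag_intertwineP m n (u : 'rV[F]_m) (v : 'rV[F]_n) (X : 'M[F]_(m, n)) :
  diag_mx u *m X = X *m diag_mx v <->
  forall a b, X a b != 0 -> u 0 a = v 0 b.
Proof.
rewrite mul_diag_mx mul_mx_diag; split=> [/matrixP E a b Xab|E].
  by have := E a b; rewrite !mxE [RHS]mulrC => /(mulIf Xab).
apply/matrixP => a b; rewrite !mxE [RHS]mulrC.
by have [->|/E ->] := eqVneq (X a b) 0; rewrite ?mulr0.
Qed.

Lemma unitmx_transversal n (X : 'M[F]_n) :
  X \in unitmx -> exists s : 'S_n, forall i, X (s i) i != 0.
Proof.
(* Transposing first makes the factors of the Leibniz formula [X (s i) i] instead of [X i (s i)]. *)
rewrite -unitmx_tr unitmxE unitfE => X0; apply: contrapT => nX.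
case/eqP: X0; apply: big1 => s _; apply/eqP; rewrite mulf_eq0; apply/orP; right.
apply/negPn/negP => /prodf_neq0 Xs; apply: nX; exists s => i.
by have := Xs i isT; rewrite mxE.
Qed.

(** The support condition makes [Z] commute with the diagonal matrix of [Delta M S], so [S *m Z]
    keeps the eigenvalue vector of [S], and [Pmx F s] permutes its columns. *)
Lemma diagonalizers_mul_Pmx n (M S Z : 'M[F]_n) (s : 'S_n) :
  diagonalizers M S -> Z \in unitmx ->
  (forall a b, Z a b != 0 -> Delta M S 0 a = Delta M S 0 b) ->
  diagonalizers M (S *m Z *m Pmx F s)
  /\ Delta M (S *m Z *m Pmx F s) = permute_vec s (Delta M S).
Proof.
move=> SM Zu ZS; have [Su _] := SM.
apply: mul_diagonalizers; first by rewrite !unitmx_mul Su Zu Pmx_unit.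
rewrite -mulmxA mulmxA (diagonalizers_mul SM) -!mulmxA; congr (S *m _).
rewrite [RHS]mulmxA; apply/diag_intertwineP => a b.
by rewrite mul_Pmx [RHS]mxE; apply: ZS.
Qed.

(* A nonzero term in the expansion of the determinant of [S^-1 T] gives the
   permutation. *)
Lemma common_diagonalizers_factor n q (M : 'I_q -> 'M[F]_n) (S T : 'M[F]_n) :
  S \in unitmx -> T \in unitmx ->
  common_diagonalizers M S -> common_diagonalizers M T ->
  exists (s : 'S_n) (Z : 'M[F]_n),
    [/\ T = S *m Z *m Pmx F s, Z \in unitmx,
        forall a b, Z a b != 0 ->
          forall j, Delta (M j) S 0 a = Delta (M j) S 0 b
      & forall j, Delta (M j) T = permute_vec s (Delta (M j) S)].
Proof.
move=> Su Tu SM TM; pose X := invmx S *m T.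
have TE : T = S *m X by rewrite mulmxA mulmxV // mul1mx.
have Xu : X \in unitmx by rewrite unitmx_mul unitmx_inv Su.
have XP j : forall a b, X a b != 0 -> Delta (M j) S 0 a = Delta (M j) T 0 b.
  apply/diag_intertwineP.
  have := diagonalizers_mul (TM j I); rewrite {1 2}TE mulmxA.
  rewrite (diagonalizers_mul (SM j I)) -!mulmxA => /(congr1 (mulmx (invmx S))).
  by rewrite !mulmxA mulVmx // !mul1mx.
have [s Xs] := unitmx_transversal Xu.
have ST j b : Delta (M j) T 0 b = Delta (M j) S 0 (s b) by rewrite (XP _ _ _ (Xs b)).
pose Z := X *m invmx (Pmx F s).
have ZE : X = Z *m Pmx F s by rewrite -mulmxA mulVmx ?Pmx_unit // mulmx1.
exists s, Z; split.
- by rewrite -mulmxA -ZE.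
- by rewrite unitmx_mul Xu unitmx_inv Pmx_unit.
(* Column [b] of [Z] is column [s^-1 b] of [X]; passing from [S] to [T] along [X] and back along [s]
   returns to [b]. *)
- move=> a b; rewrite -[b](permKV s) -mul_Pmx -ZE => Xab j.
  by rewrite (XP _ _ _ Xab) ST.
- by move=> j; apply/rowP => i; rewrite [RHS]mxE ST.
Qed.

End CommonDiagonalizers.

(** * Block diagonal matrices: support and invertibility *)

Section DirectSum.
Variables (F : fieldType) (n c : nat) (sz : 'I_c -> nat).
Variable e : (\sum_(p < c) sz p)%N = n.

Definition block_of (x : 'I_n) : 'I_c := tagnat.sig1 (cast_ord (esym e) x).

Lemma direct_sum_support (Y : forall p, 'M[F]_(sz p)) a b :
  direct_sum e Y a b != 0 -> block_of a = block_of b.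
Proof.
move=> Yab; apply/eqP; apply: contraNT Yab; rewrite /block_of => /negPf ab.
by rewrite /direct_sum castmxE mxE ab mxE.
Qed.

Lemma direct_sum_unitmx (Y : forall p, 'M[F]_(sz p)) :
  (forall p, Y p \in unitmx) -> direct_sum e Y \in unitmx.
Proof.
(* Eliminating [e] replaces [n] by the sum of the block sizes, so that the cast disappears. *)
move=> Yu; rewrite /direct_sum; case: _ / e; rewrite castmx_id.
suff /mulmx1_unit[] : \mxdiag_p Y p *m \mxdiag_p invmx (Y p) = 1%:M by [].
rewrite mul_mxblock_mxdiag -mxdiagZ; apply/eq_mxblock => i j.
case: eqP => [<-|_]; last by rewrite mul0mx.
by rewrite !conform_mx_id mulmxV.
Qed.

Lemma block_diag_direct_sum (Z : 'M[F]_n) :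
  Z \in unitmx -> (forall a b, Z a b != 0 -> block_of a = block_of b) ->
  exists2 Y : forall p, 'M[F]_(sz p),
    (forall p, Y p \in unitmx) & Z = direct_sum e Y.
Proof.
rewrite /block_of /direct_sum; case: _ / e Z => Z Zu ZP.
pose Y p := submxblock Z p p.
have ZE : Z = \mxdiag_p Y p.
  rewrite -[LHS]submxblockK; apply/eq_mxblock => i j.
  case: eqP => [<-|ij]; first by rewrite conform_mx_id.
  apply/matrixP => a b; rewrite !mxE; apply: contra_notP ij => /eqP/ZP.
  by rewrite !cast_ord_id !tagnat.Rank1K.
exists Y => [p|]; last by rewrite castmx_id.
(* Since [Z] is block diagonal, the diagonal block [p] of [Z *m invmx Z = 1] exhibits a right
   inverse of [Y p]; the shape of [invmx Z] does not enter. *)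
have := mulmxV Zu; rewrite [in X in X *m _]ZE -[invmx Z]submxblockK.
rewrite mul_mxdiag_mxblock => /(congr1 (fun A => submxblock A p p)).
rewrite mxblockK -mxdiagZ submxblock_diag.
by case/mulmx1_unit.
Qed.

End DirectSum.

Lemma uniq_map_inj_in (T1 T2 : eqType) (f : T1 -> T2) (s : seq T1) :
  uniq [seq f x | x <- s] -> {in s &, injective f}.
Proof.
elim: s => //= a s IHs /andP[fa /IHs{}IHs] x y; rewrite !inE.
move=> /predU1P[->|xs] /predU1P[->|ys] // fxy; last exact: IHs.
  by case/mapP: fa; exists y.
by case/mapP: fa; exists x.
Qed.

(** * Star sequences: equal entries in all the vectors versus a common block *)

Section StarVectors.
Variables (F : fieldType) (n q : nat) (m : 'I_q -> 'rV[F]_n).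
Variables (I : nat -> {fset seq nat}) (delta : seq nat -> nat).
Variables (lam : seq nat -> F) (k : seq nat -> nat).
Hypothesis star : star_vectors m I delta lam k.

Let star_lt0q : (0 < q)%N. Proof. by case: star => [[]]. Qed.

Lemma star_index_size j : (0 < j <= q)%N -> {in I j, forall a, size a = j}.
Proof.
have [[_ [c1 _ I1] _ IS] _] := star.
elim: j => [//|[_ _|j IHj /andP[_ jq]]] a.
  by rewrite I1 => /imfsetP[i _ ->].
rewrite IS // => /imfset2P[b /= bI [i _ ->]].
by rewrite size_rcons IHj //= ltnW.
Qed.

Let label j (x : nat) := nth [::] (labels k (lexi_enum (I j))) x.

Lemma star_lexi_enumS j : (0 < j < q)%N ->
  lexi_enum (I j.+1) =
    [seq rcons a i | a <- lexi_enum (I j), i <- iota 1 (delta a)].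
Proof.
move=> /[dup] jq /andP[j0 /ltnW jleq]; have [[_ _ _ IS] _] := star.
by rewrite IS // (@lexi_enum_rcons _ _ j) //; apply: star_index_size; rewrite j0.
Qed.

Lemma star_labels_parent j : (0 < j < q)%N ->
  [seq take j a | a <- labels k (lexi_enum (I j.+1))]
    = labels k (lexi_enum (I j)).
Proof.
move=> /[dup] jq /andP[j0 /ltnW jleq]; have [_ [_ _ kS _]] := star.
rewrite star_lexi_enumS // labels_parent // => a; rewrite mem_lexi_enum => aI.
  by apply: star_index_size aI; rewrite j0.
by have [] := kS _ jq _ aI.
Qed.

Lemma star_labels_size j : (0 < j <= q)%N -> size (labels k (lexi_enum (I j))) = n.
Proof.
have [_ [_ [_ k1] _ _]] := star; elim: j => [//|[_ _|j IHj /andP[_ jq]]].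
  by rewrite size_labels.
by rewrite -(size_map (take j.+1)) star_labels_parent // IHj //= ltnW.
Qed.

Let label_take j x : (0 < j < q)%N -> (x < n)%N -> take j (label j.+1 x) = label j x.
Proof.
move=> jq xn; rewrite /label -(star_labels_parent jq) (nth_map [::]) //.
by case/andP: jq => j0 jq; rewrite star_labels_size.
Qed.

Let label_mem j x : (0 < j <= q)%N -> (x < n)%N -> label j x \in I j.
Proof.
move=> jq xn; rewrite -mem_lexi_enum; apply: (@labels_sub k).
by rewrite mem_nth // star_labels_size.
Qed.

Let vec_label (j : 'I_q) (x : 'I_n) : m j 0 x = lam (label j.+1 x).
Proof.
have [_ [_ _ _ mE]] := star.
rewrite -[x in LHS](nth_ord_enum x) -(nth_map x 0 (m j 0)) ?size_enum_ord // mE.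
by rewrite -map_labels (nth_map [::]) ?star_labels_size /=.
Qed.

(** Induction on the level: once the labels of length [j] agree, those of length [j.+1] are
    siblings, and [lam] separates siblings. *)
Let vec_eq_label (x y : 'I_n) :
  (forall j, m j 0 x = m j 0 y) -> label q x = label q y.
Proof.
move=> mxy; have [[_ _ _ IS] [_ [lam1 _] lamS _]] := star.
suff H j : (0 < j <= q)%N -> label j x = label j y by apply: H; rewrite star_lt0q /=.
elim: j => [//|[_ /= q0|j IHj /andP[_ jq]]].
  apply: (uniq_map_inj_in lam1); rewrite ?mem_lexi_enum ?label_mem //.
  by have := mxy (Ordinal q0); rewrite !vec_label.
(* The vector of 0-based index [j.+1] is read off the labels of length [j.+2]. *)
have := mxy (Ordinal jq); rewrite !vec_label /=.
have jq' : (0 < j.+1 < q)%N by [].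
have := IHj (ltnW jq); rewrite -!(label_take jq') //.
have [lx ly] : label j.+2 x \in I j.+2 /\ label j.+2 y \in I j.+2.
  by rewrite !label_mem.
move: lx ly; rewrite IS // => /imfset2P[a /= aI [i iP ->]].
move=> /imfset2P[b /= bI [l lP ->]].
have sz c : c \in I j.+1 -> size c = j.+1 by apply: star_index_size; apply: ltnW.
rewrite -!cats1 !take_size_cat ?sz // => ab; rewrite -{}ab !cats1 in bI lP *.
have [lam_uniq _] := lamS _ jq' _ aI.
by move/(uniq_map_inj_in lam_uniq iP) => ->.
Qed.

Let label_eq_vec (x y : 'I_n) :
  label q x = label q y -> forall j, m j 0 x = m j 0 y.
Proof.
move=> xy j; rewrite !vec_label; congr lam.
(* Descent from level [q] by truncation; the bound on [d] keeps the level at least 1, where labels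
   are meaningful. *)
suff H d : (d <= q.-1)%N -> label (q - d) x = label (q - d) y.
  have := H (q - j.+1)%N; rewrite subKn //; apply.
  by rewrite -subn1 leq_sub2l.
elim: d => [|d IHd] dq; first by rewrite subn0.
have dlt : (d < q)%N by rewrite -(prednK star_lt0q) ltnW.
have E : (q - d = (q - d.+1).+1)%N by rewrite subnSK.
have := congr1 (take (q - d.+1)) (IHd (ltnW dq)); rewrite E !label_take //.
all: rewrite subn_gt0 -ltn_predRL dq /=.
all: by rewrite ltn_subrL.
Qed.

(** Both sides amount to equality of the labels of length [q]; the enumeration of [I q] has no
    repetition, so a label determines its block number. *)
Lemma star_block_ofP (e : (\sum_(p < #|` I q|) block_size k p)%N = n) (x y : 'I_n) :
  (forall j, m j 0 x = m j 0 y) <-> block_of e x = block_of e y.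
Proof.
have labelE (z : 'I_n) : label q z = nth [::] (lexi_enum (I q)) (block_of e z).
  by rewrite -labels_sig1 // size_sort.
split=> [/vec_eq_label|xy]; last by apply: label_eq_vec; rewrite !labelE xy.
rewrite !labelE => /eqP; rewrite nth_uniq ?lexi_enum_uniq ?size_sort //.
by move/eqP/val_inj.
Qed.

End StarVectors.

Theorem theorem5p5 (R : realType) (n q : nat) (M : 'I_q -> 'M[R[i]]_n)
    (S : 'M[R[i]]_n) (I : nat -> {fset seq nat}) (delta : seq nat -> nat)
    (lam : seq nat -> R[i]) (k : seq nat -> nat)
    (Mcomm : forall i j, comm_mx (M i) (M j))
    (Mdiag : forall j, diagonalizable (M j))
    (SM : common_diagonalizers M S)
    (star : star_vectors (fun j => Delta (M j) S) I delta lam k) :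
  let blocks (Y : forall p : 'I_#|` I q|, 'M[R[i]]_(block_size k p)) :=
    direct_sum (star_block_size star) Y in
  [/\ forall v : 'I_q -> 'rV[R[i]]_n, induced_vectors M v ->
        exists s : 'S_n, forall j, v j = permute_vec s (Delta (M j) S),
      common_diagonalizers M =
        [set T | exists (s : 'S_n)
                   (Y : forall p : 'I_#|` I q|, 'M[R[i]]_(block_size k p)),
                 (forall p, Y p \in unitmx) /\
                 T = S *m blocks Y *m Pmx _ s]
    & forall (j : 'I_q) (s : 'S_n)
        (Y : forall p : 'I_#|` I q|, 'M[R[i]]_(block_size k p)),
        (forall p, Y p \in unitmx) ->
        Delta (M j) (S *m blocks Y *m Pmx _ s)
          = permute_vec s (Delta (M j) S)].
Proof.
(* Some index [j] must exist for membership in the intersection to yield invertibility. *)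
have q0 : (0 < q)%N by case: star => [[]].
have unit_of T : common_diagonalizers M T -> T \in unitmx.
  by move=> /(_ (Ordinal q0) Logic.I)[].
(* This serves both the inclusion from right to left and the formula for [Delta]: the direct sum
   vanishes off the blocks, and each induced vector is constant on a block. *)
have blocksP j s Y : (forall p, Y p \in unitmx) ->
    diagonalizers (M j) (S *m direct_sum (star_block_size star) Y *m Pmx _ s)
    /\ Delta (M j) (S *m direct_sum (star_block_size star) Y *m Pmx _ s)
       = permute_vec s (Delta (M j) S).
  move=> Yu; apply: diagonalizers_mul_Pmx (SM j Logic.I) _ _.
    exact: direct_sum_unitmx.
  by move=> a b /direct_sum_support/(star_block_ofP star _ _ _).2 /(_ j).
move=> blocks; split=> [v [T TM vE]||j s Y Yu]; last exact: (blocksP j s Y Yu).2.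
  have [s [Z [_ _ _ TE]]] :=
    common_diagonalizers_factor (unit_of _ SM) (unit_of _ TM) SM TM.
  by exists s => j; rewrite vE TE.
apply/seteqP; split=> [T TM|_ [s [Y [Yu ->]]] j _ /=]; last first.
  exact: (blocksP j s Y Yu).1.
have [s [Z [TE Zu ZP _]]] :=
  common_diagonalizers_factor (unit_of _ SM) (unit_of _ TM) SM TM.
have [|Y Yu ZE] := block_diag_direct_sum (e := star_block_size star) Zu.
  by move=> a b /ZP /(star_block_ofP star _ _ _).1.
by exists s, Y; split=> //; rewrite /blocks -ZE.
Qed.
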